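(* For every odd integer $\Delta\geq 11$ there is a chordal graph $G$ with tree-width $2$, maximum degree $\Delta$, and tree-partition-width $\mathrm{tpw}(G)\geq\tfrac{2}{3}(\Delta-1)$.
   Context: All graphs are finite, simple and undirected. A graph is chordal if every induced cycle is a triangle. A graph $H$ is a partition of a graph $G$ if each vertex of $H$ (called a bag) is a set of vertices of $G$, every vertex of $G$ lies in exactly one bag, and distinct bags $A,B$ are adjacent in $H$ if and only if some edge of $G$ has one endpoint in $A$ and the other in $B$. The width of a partition is the maximum number of vertices in a bag. If a forest $T$ is a partition of $G$, then $T$ is a tree-partition of $G$. The tree-partition-width $\mathrm{tpw}(G)$ is the minimum width of a tree-partition of $G$. *)

(* Defs.v *)
From HB Require Import structures.
From mathcomp Require Import all_boot all_order all_algebra.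
From mathcomp Require Import boolp.

Set Implicit Arguments.
Unset Strict Implicit.
Unset Printing Implicit Defensive.

Record sgraph := SGraph {
  vertex :> finType;
  adj : rel vertex;
  adj_sym : symmetric adj;
  adj_irrefl : irreflexive adj }.

Notation "x -- y" := (adj x y) (at level 30) : bool_scope.

Definition degree (G : sgraph) (v : G) : nat := #|[set w : G | v -- w]|.

Definition max_degree (G : sgraph) : nat := \max_(v : G) degree v.

(* The vertices of [c], in cyclic order, span an induced cycle of [G]: two of
   them are adjacent in [G] exactly when they are consecutive in [c]. *)
Definition induced_cycle (G : sgraph) (c : seq G) : Prop :=
  [/\ 3 <= size c, uniq c &
      {in c &, forall x y : G, x -- y = (y == next c x) || (x == next c y)}].

Definition chordal (G : sgraph) : Prop :=
  forall c : seq G, induced_cycle c -> size c = 3.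

(* A [ucycle] of size 2 merely traverses an edge back and forth. *)
Definition is_forest (G : sgraph) : Prop :=
  forall c : seq G, ucycle (@adj G) c -> size c < 3.

Definition is_tree (G : sgraph) : Prop :=
  [/\ 0 < #|G|, is_forest G & forall x y : G, connect (@adj G) x y].

Definition tree_decomposition (G T : sgraph) (B : T -> {set G}) : Prop :=
  [/\ is_tree T,
      forall v : G, exists t : T, v \in B t,
      forall v w : G, v -- w -> exists t : T, (v \in B t) && (w \in B t) &
      forall (v : G) (s t : T), v \in B s -> v \in B t ->
        connect [rel a b : T | [&& v \in B a, v \in B b & a -- b]] s t].

(* Because of the truncated predecessor, the graph without vertices gets
   tree-width 0 rather than -1. *)
Definition decomposition_width (G T : sgraph) (B : T -> {set G}) : nat :=
  (\max_(t : T) #|B t|).-1.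

Definition has_tree_decomposition (G : sgraph) (k : nat) : Prop :=
  exists (T : sgraph) (B : T -> {set G}),
    tree_decomposition B /\ decomposition_width B = k.

Definition point_graph : sgraph :=
  @SGraph unit (fun _ _ => false) (fun _ _ => erefl) (fun _ => erefl).

Lemma has_tree_decomposition_ex (G : sgraph) :
  exists k, `[< has_tree_decomposition G k >].
Proof.
exists (#|G|.-1); apply/asboolP; exists point_graph, (fun=> setT); split.
  split=> [|v|v w _|v [] [] _ _]; last exact: connect0.
  - split; [by rewrite card_unit | | by move=> [] []; exact: connect0].
    by move=> [|[] [|[] c]] //; rewrite /ucycle /=.
  - by exists tt; rewrite inE.
  - by exists tt; rewrite !inE.
rewrite /decomposition_width; congr _.-1.
by rewrite (eq_bigl (pred1 tt)) ?big_pred1_eq ?cardsT // => -[].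
Qed.

Definition treewidth (G : sgraph) : nat :=
  ex_minn (has_tree_decomposition_ex G).

(* [P] is the set of bags. Unlike with [partition], [set0 \in P] is allowed: an
   empty bag is just an isolated vertex of the graph of bags. *)
Definition vertex_partition (G : sgraph) (P : {set {set G}}) : Prop :=
  forall v : G, exists! A : {set G}, A \in P /\ v \in A.

Definition bag_adj (G : sgraph) (P : {set {set G}}) : rel {A : {set G} | A \in P} :=
  fun A B => (A != B) && [exists x in val A, exists y in val B, x -- y].

Lemma bag_adj_sym (G : sgraph) (P : {set {set G}}) :
  symmetric (@bag_adj G P).
Proof.
have H A B : bag_adj A B -> bag_adj B A.
  case/andP=> neq /exists_inP[x xA /exists_inP[y yB xy]].
  rewrite /bag_adj eq_sym neq; apply/exists_inP; exists y => //.
  by apply/exists_inP; exists x; rewrite // adj_sym.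
by move=> A B; apply/idP/idP; apply: H.
Qed.

Lemma bag_adj_irrefl (G : sgraph) (P : {set {set G}}) :
  irreflexive (@bag_adj G P).
Proof. by move=> A; rewrite /bag_adj eqxx. Qed.

Definition bag_graph (G : sgraph) (P : {set {set G}}) : sgraph :=
  SGraph (@bag_adj_sym G P) (@bag_adj_irrefl G P).

Definition tree_partition (G : sgraph) (P : {set {set G}}) : Prop :=
  vertex_partition P /\ is_forest (bag_graph P).

Definition partition_width (G : sgraph) (P : {set {set G}}) : nat :=
  \max_(A in P) #|A|.

Definition has_tree_partition (G : sgraph) (k : nat) : Prop :=
  exists P : {set {set G}}, tree_partition P /\ partition_width P = k.

Lemma has_tree_partition_ex (G : sgraph) :
  exists k, `[< has_tree_partition G k >].
Proof.
exists #|G|; apply/asboolP; exists [set setT]; split; last first.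
  by rewrite /partition_width big_set1 cardsT.
split=> [v|c /andP[_ uc]].
  exists setT; split=> [|A]; first by rewrite !inE.
  by case=> /set1P->.
suff le1 : size c <= 1 by exact: leq_ltn_trans le1 _.
rewrite -(card_uniqP uc); apply: leq_trans (max_card _) _.
by rewrite card_sig cards1.
Qed.

Definition tpw (G : sgraph) : nat := ex_minn (has_tree_partition_ex G).

(* Main.v *)
Require Import Defs.
From HB Require Import structures.
From mathcomp Require Import all_boot all_order all_algebra.
From mathcomp Require Import boolp.
From mathcomp Require Import zify lra.

Set Implicit Arguments.
Unset Strict Implicit.
Unset Printing Implicit Defensive.

(* Let Delta = m + 2 and h = (Delta - 3) / 2. The graph is a fan with hub r and
   rim path v_0 ... v_(m+1) in which every rim edge v_i v_(i+1) carries h extra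
   common neighbours (ears). In a tree-partition of width w, the ends of every
   triangle meet at most two bags, as the bags form a forest. Let R be the bag
   of r. Consecutive rim vertices outside R hence share a bag, and the ears of a
   rim edge with exactly one end in R lie in R or in the bag of the other end.
   If there are k such switching edges, the rim meets f <= k / 2 + 1 bags other
   than R, and these bags together with R contain r, the rim and k h ears, so
   that Delta + 1 + k h <= (f + 1) w. For k > 0 this gives
   2 (Delta - 1) <= 3 w; for k = 0 a single bag contains the whole rim. *)

(** * Chordality from an elimination ordering *)

(** A vertex [x] of the cycle with maximal [f] works: [f] differs at the ends of every edge, so both
    cyclic neighbours of [x] are strictly lower. *)
Lemma cycle_peak (T : eqType) (e : rel T) (f : T -> nat) (c : seq T) :
  symmetric e -> (forall x y, e x y -> f x != f y) ->
  cycle e c -> 2 < size c ->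
  exists i x a s b, [/\ rot i c = x :: a :: rcons s b, e x a && e x b,
    f a < f x & f b < f x].
Proof.
move=> esym ef cc sc.
have [x xc xmax] : exists2 x, x \in c & forall y, y \in c -> f y <= f x.
  have: c != [::] by case: c sc {cc}.
  elim: c {cc sc} => // y c IHc _; have [->|/IHc[x xc xmax]] := eqVneq c [::].
    by exists y; rewrite ?mem_head // => z; rewrite inE => /eqP->.
  case: (leqP (f x) (f y)) => fxy; [exists y | exists x]; rewrite ?mem_head //.
  - move=> z; rewrite inE => /predU1P[->//|/xmax]; by move/leq_trans; apply.
  - by rewrite inE xc orbT.
  - by move=> z; rewrite inE => /predU1P[->|/xmax//]; exact: ltnW.
have [i [|a s] rE] := rot_to xc.
  by have:= congr1 size rE; rewrite size_rot => sz; rewrite sz in sc.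
have:= size_rot i c; rewrite rE; case/lastP: s => [|s b] in rE *.
  by move=> /= sz; rewrite -sz in sc.
move=> _; exists i, x, a, s, b.
have [ac bc] : a \in c /\ b \in c.
  have memr := mem_rot i c; rewrite rE in memr.
  by split; rewrite -memr !(inE, mem_rcons) eqxx ?orbT.
move: cc; rewrite -(rot_cycle i) rE /= rcons_path last_rcons.
case/and3P=> xa _ bx; rewrite xa esym bx; split=> //.
  by rewrite ltn_neqAle eq_sym ef //= xmax.
by rewrite ltn_neqAle ef //= xmax.
Qed.

(** The values of [f] encode a perfect elimination ordering. At a peak of an induced cycle both
    neighbours are lower, hence adjacent, which leaves no room for a fourth vertex. *)
Lemma chordal_elimination (G : sgraph) (f : G -> nat) :
  (forall x y : G, x -- y -> f x != f y) ->
  (forall x y z : G, x -- y -> x -- z -> f y < f x -> f z < f x ->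
     y != z -> y -- z) ->
  chordal G.
Proof.
move=> fadj fclique c [sc uc ind].
have cc : cycle (@adj G) c.
  by rewrite (cycle_from_next uc) // => x xc; rewrite ind ?mem_next // eqxx.
have [i [x [a [s [b [rE /andP[xa xb] fa fb]]]]]] :=
  cycle_peak (@adj_sym G) fadj cc sc.
have ur : uniq (x :: a :: rcons s b) by rewrite -rE rot_uniq.
have [ac bc] : a \in c /\ b \in c.
  have memr := mem_rot i c; rewrite rE in memr.
  by split; rewrite -memr !(inE, mem_rcons) eqxx ?orbT.
have ab : a != b.
  by move: ur; rewrite /= mem_rcons inE negb_or; case/and3P=> _ /andP[].
have nE y : next c y = next (x :: a :: rcons s b) y by rewrite -rE next_rot.
have := cycle_next ur.
set n := next (x :: _) in nE *; rewrite /= rcons_path last_rcons.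
case/and3P=> _ pa /eqP nb.
have := fclique _ _ _ xa xb fa fb ab.
(* On an induced cycle, [a -- b] makes one of the two the successor of the other. As [next b] is
   [x], [b] directly follows [a], and so [s] is empty. *)
rewrite ind // !nE nb -(size_rot i) rE /= size_rcons.
have /negPf-> : a != x by move: fa; apply: contraTneq => ->; rewrite ltnn.
rewrite orbF; clearbody n; case: s pa ur {rE nE nb} => //=.
move=> d s /andP[/eqP-> _] ur /eqP bd.
by move: ur; rewrite mem_rcons bd mem_head !andbF.
Qed.

(** * Trees encoded by parent maps *)

(** Roots are the fixed points of [par]; the conjunct [a != b] drops the loops they would
    produce. *)
Definition parent_adj (T : eqType) (par : T -> T) : rel T :=
  [rel a b | (a != b) && ((par a == b) || (par b == a))].

Lemma parent_adj_sym (T : eqType) (par : T -> T) : symmetric (parent_adj par).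
Proof. by move=> a b; rewrite /parent_adj /= eq_sym orbC. Qed.

Lemma parent_adj_irrefl (T : eqType) (par : T -> T) :
  irreflexive (parent_adj par).
Proof. by move=> a; rewrite /parent_adj /= eqxx. Qed.

Definition parent_graph (T : finType) (par : T -> T) : sgraph :=
  SGraph (parent_adj_sym par) (@parent_adj_irrefl T par).

(** At a peak of a cycle both neighbours would be the parent of the peak, hence equal. *)
Lemma parent_graph_forest (T : finType) (par : T -> T) (f : T -> nat) :
  (forall t, par t != t -> f (par t) < f t) -> is_forest (parent_graph par).
Proof.
move=> fpar c /andP[cc uc]; rewrite ltnNge; apply/negP=> sc.
have fadj a b : parent_adj par a b -> f a != f b.
  case/andP=> ab /orP[] /eqP E.
    have := fpar a; rewrite E eq_sym ab => /(_ isT).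
    by rewrite ltn_neqAle eq_sym => /andP[].
  by have := fpar b; rewrite E ab => /(_ isT); rewrite ltn_neqAle => /andP[].
have low a b : parent_adj par a b -> f b < f a -> par a = b.
  case/andP=> ab /orP[] /eqP E // fba.
  by have := fpar b; rewrite E ab => /(_ isT); rewrite ltnNge ltnW.
have [i [x [a [s [b [rE /andP[xa xb] fa fb]]]]]] :=
  cycle_peak (parent_adj_sym par) fadj cc sc.
move: uc; rewrite -(rot_uniq i) rE /= -(low _ _ xa fa) (low _ _ xb fb).
by rewrite mem_rcons mem_head andbF.
Qed.

(** Climbing to parents stays in [S] and lowers [f], so it ends at [t0]. Taking all nodes for [S]
    gives connectedness of a tree; taking the nodes whose bags contain a fixed vertex gives the
    subtree condition. *)
Lemma connect_ancestor (T : finType) (par : T -> T) (f : T -> nat)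
    (S : pred T) (t0 : T) :
  (forall t, par t != t -> f (par t) < f t) ->
  (forall t, S t -> t != t0 -> par t != t /\ S (par t)) ->
  forall s t, S s -> S t ->
    connect [rel a b | [&& S a, S b & parent_adj par a b]] s t.
Proof.
move=> fpar Spar; set e := [rel a b | _].
have esym : symmetric e.
  by move=> a b; rewrite /e [LHS]/= parent_adj_sym andbCA.
suff top t : S t -> connect e t t0.
  move=> s t Ss St; apply: connect_trans (top _ Ss) _.
  by rewrite (sym_connect_sym esym) top.
have [n] := ubnP (f t); elim: n t => // n IHn t /ltnSE ftn St.
have [->|t0t] := eqVneq t t0; first exact: connect0.
have [pt Sp] := Spar t St t0t.
apply: connect_trans (IHn _ _ Sp); last exact: leq_trans (fpar _ pt) ftn.
by apply: connect1; rewrite /e /= St Sp /parent_adj /= eq_sym pt eqxx.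
Qed.

(** * Tree-width of a graph with a triangle *)

(** A simple path from [b] to [a] avoiding the edge has at least three vertices, and the edge would
    close it to a cycle. *)
Lemma forest_bridge (T : sgraph) (a b : T) : is_forest T -> a -- b ->
  ~~ connect [rel u v : T | [&& u -- v & [set u; v] != [set a; b]]] b a.
Proof.
move=> forT ab; apply/negP=> /connectP[p0 pth0 last0].
case/shortenP: pth0 last0 => p pth up _ E.
have: path (@adj T) b p.
  by apply: sub_path pth => u v /andP[].
case: p => [|u [|v p]] in pth up E *.
- by move: ab; rewrite E adj_irrefl.
- by move: pth; rewrite E /= setUC eqxx !andbF.
- move=> pth'.
  suff /forT : ucycle (@adj T) [:: b, u, v & p] by [].
  by rewrite /ucycle up andbT /cycle rcons_path pth' -E.
Qed.

(** Cut the path after its last vertex in [P]; the first alternative is the case without such a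
    vertex. *)
Lemma path_exit (T : finType) (e : rel T) (P : pred T) (s : T) (p : seq T) :
  path e s p -> ~~ P (last s p) ->
  (~~ P s /\
   connect [rel u v | [&& e u v, ~~ P u & ~~ P v]] s (last s p)) \/
  exists a b, [/\ e a b, P a, ~~ P b &
    connect [rel u v | [&& e u v, ~~ P u & ~~ P v]] b (last s p)].
Proof.
elim: p s => [|c p IHp] s /=; first by move=> _ Ps; left.
case/andP=> sc pth Pl; have [[Pc con]|] := IHp c pth Pl; last by right.
have [Ps|nPs] := boolP (P s); first by right; exists s, c.
by left; split=> //; apply: connect_trans (connect1 _) con; rewrite /= sc nPs.
Qed.

(** This is the Helly property of subtrees: three that meet pairwise share a node, so some bag
    contains the triangle. *)
Lemma triangle_decomposition_width (G T : sgraph) (B : T -> {set G})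
    (x y z : G) :
  tree_decomposition B -> x -- y -> y -- z -> x -- z ->
  2 <= decomposition_width B.
Proof.
move=> [[_ forT _] _ edgeB conB] xy yz xz.
have neq (u v : G) : u -- v -> u != v.
  by apply: contraTneq => ->; rewrite adj_irrefl.
have nxy := neq _ _ xy; have nyz := neq _ _ yz; have nxz := neq _ _ xz.
suff [t st] : exists t, 2 < #|B t|.
  rewrite /decomposition_width -ltnS (leq_trans st) //.
  by rewrite (leq_trans _ (leqSpred _)) // (leq_bigmax t).
have [//|small] := pselect (exists t, 2 < #|B t|).
have no3 t : ~~ [&& x \in B t, y \in B t & z \in B t].
  apply/negP=> /and3P[xt yt zt]; apply: small; exists t.
  have: #|[set x; y; z]| = 3.
    by rewrite -setUA cardsU1 cards2 !inE negb_or nxy nxz nyz.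
  move<-; apply: subset_leq_card; apply/subsetP=> u.
  by rewrite !inE => /orP[/orP[]|] /eqP->.
have [s /andP[xs ys]] := edgeB _ _ xy.
have [t /andP[yt zt]] := edgeB _ _ yz.
have [u /andP[xu zu]] := edgeB _ _ xz.
have nxt : x \notin B t by have := no3 t; rewrite yt zt !andbT.
(* The tree edge a b leaves the bags containing x for the last time on a path of
   bags containing y. Going round the triangle through bags containing y but not
   x, then z, then x leads back from b to a without using that edge. *)
have /connectP[p pth E] := conB y s t ys yt.
have := @path_exit T _ (fun t => x \in B t) s p pth; rewrite -E => /(_ nxt).
case=> [[]|[a [b [/and3P[ya yb ab] xa nxb con]]]]; first by rewrite xs.
have nza : z \notin B a by have := no3 a; rewrite xa ya.
have := forest_bridge forT ab; case/negP.
(* A walk through nodes satisfying [P] cannot use the edge a b if one of its ends violates [P]. *)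
have avoid (P : pred T) v w : ~~ (P a && P b) ->
    connect [rel c d : T | [&& P c, P d & c -- d]] v w ->
    connect [rel c d : T | [&& c -- d & [set c; d] != [set a; b]]] v w.
  move=> nP; apply: connect_sub => c d /and3P[Pc Pd cd]; apply: connect1.
  rewrite /= cd; apply: contra nP => /eqP E'.
  have: a \in [set c; d] by rewrite E' !inE eqxx.
  have: b \in [set c; d] by rewrite E' !inE eqxx orbT.
  by rewrite !inE => /orP[] /eqP-> /orP[] /eqP->; rewrite ?Pc ?Pd.
apply: (@connect_trans _ _ t).
  apply: (avoid (fun t => x \notin B t)); first by rewrite xa.
  apply: connect_sub con => c d /and3P[/and3P[_ _ cd] xc xd].
  by apply: connect1; rewrite /= xc xd.
apply: (@connect_trans _ _ u).
  apply: (avoid (fun t => z \in B t)); last exact: conB.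
  by rewrite (negPf nza).
apply: (avoid (fun t => x \in B t)); last exact: conB.
by rewrite (negPf nxb) andbF.
Qed.

(** * Bags of a tree-partition along triangles and paths *)

Lemma pblock_vertex_partition (G : sgraph) (P : {set {set G}}) (v : G) :
  vertex_partition P -> (pblock P v \in P) && (v \in pblock P v).
Proof.
move=> partP; have [A [[AP vA] _]] := partP v.
have vc : v \in cover P by apply/bigcupP; exists A.
by rewrite mem_pblock vc pblock_mem.
Qed.

(** Three distinct bags would be pairwise adjacent, a 3-cycle in the forest of bags. *)
Lemma tree_partition_triangle (G : sgraph) (P : {set {set G}}) (x y z : G) :
  tree_partition P -> x -- y -> y -- z -> x -- z ->
  [|| pblock P x == pblock P y, pblock P y == pblock P z
    | pblock P x == pblock P z].
Proof.
move=> [partP forP] xy yz xz; apply: contraT.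
rewrite !negb_or => /and3P[nxy nyz nxz].
have memP v : pblock P v \in P by case/andP: (pblock_vertex_partition v partP).
have memv v : v \in pblock P v by case/andP: (pblock_vertex_partition v partP).
pose b v : bag_graph P := exist _ (pblock P v) (memP v).
have badj u v : u -- v -> pblock P u != pblock P v -> bag_adj (b u) (b v).
  move=> uv nuv; rewrite /bag_adj -val_eqE /= nuv.
  by apply/exists_inP; exists u => //; apply/exists_inP; exists v.
suff /forP : ucycle (@adj (bag_graph P)) [:: b x; b y; b z] by [].
apply/andP; split.
  by rewrite /= !badj // 1?adj_sym // eq_sym.
by rewrite /= !inE -!val_eqE /= negb_or nxy nyz nxz.
Qed.

(** Outside [R] the value of [b] is constant on runs. Each run starts at index 0 or just after a
    step leaving [R]. *)
Lemma card_entries (T : finType) (m : nat) (b : nat -> T) (R : T) :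
  (forall i, i < m -> [|| b i == R, b i.+1 == R | b i == b i.+1]) ->
  #|[set b j | j : 'I_m.+1] :\ R| <=
    #|[set i : 'I_m | (b i == R) && (b i.+1 != R)]|.+1.
Proof.
move=> b_step; set E := [set i | _].
apply: (@leq_trans #|b 0 |: [set b i.+1 | i : 'I_m in E]|).
  apply/subset_leq_card/subsetP=> A /setD1P[nR /imsetP[[j jm] _ /= bj]].
  rewrite {A}bj in nR *;
  elim: j jm nR => [|j IHj] jm nR; first by rewrite !inE eqxx.
  case: (eqVneq (b j) R) => [bjR|nbjR].
    rewrite inE; apply/orP; right; apply/imsetP.
    by exists (Ordinal (jm : j < m)); rewrite // inE /= bjR eqxx.
  have:= b_step j jm; rewrite (negPf nR) (negPf nbjR) /= => /eqP <-.
  exact: IHj (ltnW jm) nbjR.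
by rewrite cardsU1 -add1n leq_add ?leq_b1 // leq_imset_card.
Qed.

(** Mirror image of [card_entries]: each run ends at index [m] or just before a step into [R]. The
    two bounds together give half the number of switches plus one. *)
Lemma card_exits (T : finType) (m : nat) (b : nat -> T) (R : T) :
  (forall i, i < m -> [|| b i == R, b i.+1 == R | b i == b i.+1]) ->
  #|[set b j | j : 'I_m.+1] :\ R| <=
    #|[set i : 'I_m | (b i != R) && (b i.+1 == R)]|.+1.
Proof.
move=> b_step; set E := [set i | _].
apply: (@leq_trans #|b m |: [set b i | i : 'I_m in E]|).
  apply/subset_leq_card/subsetP=> A /setD1P[nR /imsetP[[j jm] _ /= bj]].
  (* Induction on [m - j] follows the run to its last index. *)
  rewrite {A}bj in nR *; have [n] := ubnP (m - j).
  elim: n j jm nR => // n IHn j jm nR mj.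
  have [->|njm] := eqVneq j m; first by rewrite !inE eqxx.
  have {jm njm}jm : j < m by rewrite ltn_neqAle njm.
  case: (eqVneq (b j.+1) R) => [bjR|nbjR].
    rewrite inE; apply/orP; right; apply/imsetP.
    by exists (Ordinal jm); rewrite // inE /= nR bjR eqxx.
  have:= b_step j jm; rewrite (negPf nR) (negPf nbjR) /= => /eqP ->.
  by apply: IHn => //; lia.
by rewrite cardsU1 -add1n leq_add ?leq_b1 // leq_imset_card.
Qed.

Lemma no_switch_constant (T : finType) (m : nat) (b : nat -> T) (R : T) :
  (forall i, i < m -> [|| b i == R, b i.+1 == R | b i == b i.+1]) ->
  (forall i, i < m -> (b i == R) = (b i.+1 == R)) ->
  forall j, j <= m -> b j = b 0.
Proof.
move=> b_step noswitch; elim=> // j IHj jm; rewrite -IHj 1?ltnW //.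
have:= b_step j jm; have:= noswitch _ jm.
by case: eqP => [-> /esym/eqP|_ <- /eqP].
Qed.

(** * The fan with ears *)

(** The summands are the hub, the rim vertices, and the ears, with [(i, l)] the [l]-th ear on the
    edge v_i v_(i+1). Each edge is listed once, towards the larger [fan_rank]. *)
Definition fan_arc m h (x y : unit + ('I_m.+2 + 'I_m.+1 * 'I_h)) : bool :=
  match x, y with
  | inl _, inr (inl _) => true
  | inr (inl i), inr (inl j) => i.+1 == j
  | inr (inl j), inr (inr (i, _)) => (j == i :> nat) || (j == i.+1 :> nat)
  | _, _ => false
  end.

Definition fan_adj m h : rel (unit + ('I_m.+2 + 'I_m.+1 * 'I_h)) :=
  [rel x y | fan_arc x y || fan_arc y x].

Lemma fan_adj_sym m h : symmetric (@fan_adj m h).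
Proof. by move=> x y; rewrite /fan_adj /= orbC. Qed.

Lemma fan_adj_irrefl m h : irreflexive (@fan_adj m h).
Proof.
by move=> [[]|[i|[i l]]] //; rewrite /fan_adj /= orbb; apply/eqP; lia.
Qed.

Definition fan m h : sgraph := SGraph (@fan_adj_sym m h) (@fan_adj_irrefl m h).

Definition hub m h : fan m h := inl tt.
(** A [nat] index lets [j.+1] be written without a bound; [inord] sends an index beyond [m.+1] to
    v_0. *)
Definition rim m h (j : nat) : fan m h := inr (inl (inord j)).
Definition ear m h (i : 'I_m.+1) (l : 'I_h) : fan m h := inr (inr (i, l)).

Definition fan_rank m h (x : fan m h) : nat :=
  match x with inl _ => 0 | inr (inl j) => j.+1 | inr (inr _) => m.+3 end.

Lemma fan_arc_rank m h (x y : fan m h) :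
  fan_arc x y -> fan_rank x < fan_rank y.
Proof.
case: x y => [[]|[i|[i l]]] [[]|[j|[j l']]] //= => [/eqP-> //|_].
by rewrite ltnS.
Qed.

(** Lower neighbours are at most the hub and v_(j-1) for v_j, and v_i and v_(i+1) for an ear:
    adjacent pairs in both cases. *)
Lemma fan_chordal m h : chordal (fan m h).
Proof.
have low (x y : fan m h) : x -- y -> fan_rank y < fan_rank x -> fan_arc y x.
  by case/orP=> // /fan_arc_rank; rewrite ltnNge => /negP lt /ltnW.
apply: (@chordal_elimination _ (@fan_rank m h)) => [x y|x y z].
  by case/orP => /fan_arc_rank; rewrite ltn_neqAle => /andP[] //;
    rewrite eq_sym.
move=> xy xz fy fz.
have {xy fy} := low _ _ xy fy; have {xz fz} := low _ _ xz fz.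
have neq_ord (i j : 'I_m.+2) :
    inr (inl i) != inr (inl j) :> fan m h -> i <> j :> nat.
  by move=> /negP ne ij; apply: ne; rewrite (val_inj ij).
rewrite /= /fan_adj /=.
case: x y z => [[]|[i|[i l]]] [[]|[j|[j l']]] [[]|[k|[k l'']]] //=.
  by move=> /eqP E1 /eqP E2 /neq_ord; lia.
by move=> E1 E2 /neq_ord; lia.
Qed.

(** The hub sees all [m.+2] rim vertices. A rim vertex has at most the hub, two rim neighbours and
    [2 * h] ears, again [m.+2]. *)
Lemma fan_max_degree m h : m = (2 * h).+1 -> max_degree (fan m h) = m.+2.
Proof.
move=> mh; have degE (v : fan m h) : degree v =
    \sum_(u : unit | v -- (inl u : fan m h)) 1 +
    (#|[set j | v -- (inr (inl j) : fan m h)]| +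
     #|[set p | v -- (inr (inr p) : fan m h)]|).
  by rewrite /degree -sum1dep_card !big_sumType /= !sum1dep_card.
have le2 (A : finType) (S : {set A}) (a a' : A) :
    S \subset [set a; a'] -> #|S| <= 2.
  by move/subset_leq_card/leq_trans; apply; rewrite cards2; case: (_ != _).
have hubE : degree (hub m h) = m.+2.
  rewrite degE big_pred0 // add0n.
  rewrite (_ : [set j : 'I_m.+2 | _] = setT) ?cardsT ?card_ord; last first.
    by apply/setP=> j; rewrite !inE.
  rewrite (_ : [set p : 'I_m.+1 * 'I_h | _] = set0) ?cards0 ?addn0 //.
apply/eqP; rewrite eqn_leq; apply/andP; split; last first.
  by rewrite -hubE; exact: leq_bigmax.
apply/bigmax_leqP=> -[[]|[j|[i l]]] _; first by apply: eq_leq; exact: hubE.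
- rewrite degE.
  have d1 : \sum_(u : unit | adj (inr (inl j) : fan m h) (inl u)) 1 <= 1.
    by rewrite sum1dep_card (leq_trans (max_card _)) // card_unit.
  have d2 : #|[set k | adj (inr (inl j) : fan m h) (inr (inl k))]| <= 2.
    (* At the ends of the rim one of these indices is a default value, harmless since only a
       superset is needed. *)
    apply: (@le2 _ _ (inord j.+1) (inord j.-1)); apply/subsetP=> k.
    rewrite !inE /= /fan_adj /= => /orP[/eqP->|/eqP <-].
      by rewrite inord_val eqxx.
    by rewrite /= inord_val eqxx orbT.
  have d3 : #|[set p | adj (inr (inl j) : fan m h) (inr (inr p))]| <= 2 * h.
    pose S := [set i : 'I_m.+1 | (j == i :> nat) || (j == i.+1 :> nat)].
    have S2 : #|S| <= 2.
      apply: (@le2 _ _ (inord j) (inord j.-1)); apply/subsetP=> k.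
      by rewrite !inE => /orP[] /eqP->; rewrite /= inord_val eqxx ?orbT.
    apply: (@leq_trans #|setX S [set: 'I_h]|); last first.
      by rewrite cardsX cardsT card_ord leq_mul2r S2 orbT.
    apply/subset_leq_card/subsetP=> -[i l].
    by rewrite !inE /= /fan_adj /= orbF andbT.
  by apply: leq_trans (leq_add d1 (leq_add d2 d3)) _; lia.
- rewrite degE big_pred0 // add0n.
  rewrite (_ : [set p : 'I_m.+1 * 'I_h | _] = set0) ?cards0 ?addn0; last first.
    by apply/setP=> -[i' l']; rewrite !inE.
  by rewrite (leq_trans (max_card _)) // card_ord.
Qed.

(** * A tree-decomposition of the fan of width 2 *)

(** A caterpillar: the nodes [(i, None)] form the spine and each [(i, Some l)] is a leaf at
    [(i, None)]. The truncated predecessor makes [(ord0, None)] the root. *)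
Definition fan_parent m h (t : 'I_m.+1 * option 'I_h) : 'I_m.+1 * option 'I_h :=
  if t is (i, Some _) then (i, None) else (inord t.1.-1, None).

Definition fan_node_rank m h (t : 'I_m.+1 * option 'I_h) : nat :=
  if t is (i, None) then i : nat else m.+1.

Definition fan_bag m h (t : 'I_m.+1 * option 'I_h) : {set fan m h} :=
  [set rim m h t.1; rim m h t.1.+1;
       if t.2 is Some l then ear t.1 l else hub m h].

Lemma fan_parent_rank m h (t : 'I_m.+1 * option 'I_h) :
  fan_parent t != t -> fan_node_rank (fan_parent t) < fan_node_rank t.
Proof.
case: t => i [l|] //=; have im := ltn_ord i; apply: contraNltn.
rewrite inordK => [ii|]; last by lia.
by apply/eqP; congr (_, _); apply: val_inj; rewrite /= inordK; lia.
Qed.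

Lemma rim_eq m h (i j : nat) : i < m.+2 -> j < m.+2 ->
  (rim m h i == rim m h j) = (i == j).
Proof.
move=> im jm; apply/eqP/eqP=> [[/(congr1 val)]|->//].
by rewrite /= !inordK.
Qed.

Lemma fan_tree_decomposition m h :
  @tree_decomposition (fan m h) (parent_graph (@fan_parent m h)) (@fan_bag m h).
Proof.
have rimE (j : 'I_m.+2) : inr (inl j) = rim m h j by rewrite /rim inord_val.
have rim_bag (j : 'I_m.+2) :
    exists i : 'I_m.+1, forall o, rim m h j \in fan_bag (i, o).
  (* Unlike [j], the index [j.-1] is that of a rim edge at v_j even for the last [j]; truncation
     covers [j = 0]. *)
  exists (inord j.-1) => o.
  rewrite !inE /= inordK; last by have := ltn_ord j; lia.
  by case: (val j) => [|k]; rewrite eqxx ?orbT.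
have top_node (t : 'I_m.+1 * option 'I_h) :
    t != (ord0, None) -> fan_parent t != t.
  case: t => i [l|]; first by move=> _ /=; rewrite xpair_eqE andbF.
  apply: contraNN => /eqP E.
  have {}E : inord i.-1 = i by case: E.
  have := congr1 val E; have im := ltn_ord i.
  rewrite /= inordK => [ii|]; last by lia.
  by apply/eqP; congr (_, _); apply: val_inj => /=; lia.
split.
- split; first by apply/card_gt0P; exists (ord0, None).
    exact: parent_graph_forest (@fan_parent_rank m h).
  move=> s t; have := @connect_ancestor _ (@fan_parent m h) _ predT (ord0, None)
    (@fan_parent_rank m h) (fun t _ nt => conj (top_node t nt) isT) s t isT isT.
  by apply: connect_sub => a b /= ab; exact: connect1.
- case=> [[]|[j|[i l]]].
  + by exists (ord0, None); rewrite !inE /= ?eqxx ?orbT.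
  + by have [i mem] := rim_bag j; exists (i, None); rewrite rimE.
  + by exists (i, Some l); rewrite !inE /= ?eqxx ?orbT.
- have arc (v w : fan m h) : fan_arc v w ->
      exists t : 'I_m.+1 * option 'I_h, (v \in fan_bag t) && (w \in fan_bag t).
    case: v w => [[]|[j|[i l]]] [[]|[k|[i' l']]] //=; rewrite ?rimE.
    + have [i mem] := rim_bag k; exists (i, None); rewrite mem.
      by rewrite !inE /= ?eqxx ?orbT.
    + move=> /eqP jk; exists (inord j, None).
      rewrite !inE /= inordK -?jk ?eqxx ?orbT //.
      by have := ltn_ord k; lia.
    + move=> E; exists (i', Some l'); rewrite !inE /= ?eqxx ?orbT.
      by case/orP: E => /eqP->; rewrite eqxx ?orbT.
  by move=> v w /orP[/arc //|/arc [t /andP[? ?]]]; exists t; apply/andP.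
(* [t0] is the topmost node whose bag contains [v]: the root for the hub, the spine node of index
   [j.-1] for v_j, its own leaf for an ear. *)
have con (v : fan m h) t0 : (forall t, v \in fan_bag t -> t != t0 ->
    fan_parent t != t /\ v \in fan_bag (fan_parent t)) ->
    forall s t, v \in fan_bag s -> v \in fan_bag t ->
    connect [rel a b : parent_graph (@fan_parent m h) |
      [&& v \in fan_bag a, v \in fan_bag b & a -- b]] s t.
  exact: connect_ancestor (@fan_parent_rank m h).
case=> [[]|[j|[i l]]].
- apply: (con _ (ord0, None)) => -[i [l|]] mem nt.
    by move: mem; rewrite !inE.
  by split; [exact: top_node | rewrite !inE eqxx !orbT].
- apply: (con _ (inord j.-1, None)) => -[i o]; rewrite rimE !inE /= => mem nt.
  have im := ltn_ord i.
  have {}mem : (j == i :> nat) || (j == i.+1 :> nat).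
    move: mem; rewrite !rim_eq ?ltn_ord //; last by lia.
    by case: o {nt} => [?|]; rewrite orbF.
  have par_mem : o = None -> j = i :> nat /\ 0 < i.
    case/orP: mem => /eqP ji oN; last by move: nt; rewrite oN ji inord_val eqxx.
    split=> //; rewrite lt0n; apply: contraNneq nt => i0.
    by rewrite oN -(inord_val i) ji i0.
  case: o nt par_mem => [l _ _|nt /(_ erefl) [ji i0]].
    split; first by rewrite /= xpair_eqE andbF.
    by rewrite /= !rim_eq ?ltn_ord ?mem //; lia.
  split; first by rewrite /= -ji eq_sym.
  by rewrite /= inordK; [rewrite prednK // ji eqxx orbT | lia].
- apply: (con _ (i, Some l)) => -[k [l'|]]; rewrite !inE //= => /eqP[-> ->].
  by rewrite eqxx.
Qed.

Lemma fan_treewidth m h : treewidth (fan m h) = 2.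
Proof.
rewrite /treewidth; case: ex_minnP => k /asboolP[T [B [decB <-]]] kmin.
apply/eqP; rewrite eqn_leq; apply/andP; split.
  pose w := decomposition_width (T := parent_graph (@fan_parent m h))
    (@fan_bag m h).
  apply: (@leq_trans w).
    apply/kmin/asboolP; exists (parent_graph (@fan_parent m h)), (@fan_bag m h).
    by split=> //; exact: fan_tree_decomposition.
  rewrite /w /decomposition_width -ltnS prednK ?ltnS; last first.
    apply: leq_trans (leq_bigmax (ord0, None)); apply/card_gt0P.
    by exists (hub m h); rewrite !inE /= ?eqxx ?orbT.
  apply/bigmax_leqP=> t _; rewrite /fan_bag cardsU cards2 cards1.
  by case: (_ != _); lia.
apply: (triangle_decomposition_width (x := hub m h) (y := rim m h 0)
  (z := rim m h 1)) => //=.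
by rewrite /fan_adj /= !inordK.
Qed.

(** * Lower bound on the width of tree-partitions of the fan *)

Lemma card_cover_leq (T : finType) (F : {set {set T}}) (w : nat) :
  (forall A, A \in F -> #|A| <= w) -> #|cover F| <= #|F| * w.
Proof.
move=> Fw; apply: leq_trans (leq_card_cover F) _.
by rewrite -sum_nat_const; apply: leq_sum.
Qed.

(** Here [kl] and [kr] count the rim edges leaving and entering the bag of the hub, and [f] the
    other bags met by the rim. *)
Lemma fan_width_arith m h kl kr f w : m = (2 * h).+1 -> 4 <= h -> 0 < kl + kr ->
  f <= kl.+1 -> f <= kr.+1 -> m.+3 + (kl + kr) * h <= f.+1 * w ->
  2 * m.+1 <= 3 * w.
Proof.
move=> -> h4 k0 fl fr; set k := kl + kr in k0 *.
have fk : 2 * f <= k.+2 by rewrite /k; lia.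
rewrite leqNgt => tot; rewrite leqNgt; apply/negP=> lt.
have {lt} w3 : 3 * w <= 4 * h + 3 by lia.
(* For [k = 1] parity improves [fk] to [f <= 1]; without this gain the estimate below is too weak
   for large [h]. *)
have [k1|k2] : k = 1 \/ 2 <= k by lia.
  have : f.+1 * w <= 2 * w by rewrite leq_mul2r; apply/orP; right; lia.
  by rewrite k1 in tot; lia.
(* Multiplying by 6 clears the denominators of f <= (k + 2) / 2 and w <= (4h + 3) / 3. With [tot]
   this yields 12 + 2h(k - 2) <= 3k, which is impossible. *)
have H : (2 * f).+2 * (3 * w) <= k.+4 * (4 * h + 3) by apply: leq_mul; lia.
nia.
Qed.

Lemma fan_tree_partition_width m h (P : {set {set fan m h}}) :
  m = (2 * h).+1 -> 4 <= h -> tree_partition P ->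
  2 * m.+1 <= 3 * partition_width P.
Proof.
move=> mh h4 treeP; have [partP _] := treeP.
set w := partition_width P.
have bagw A : A \in P -> #|A| <= w.
  by move=> AP; exact: (leq_bigmax_cond (F := fun A : {set fan m h} => #|A|)).
have memP v : pblock P v \in P by case/andP: (pblock_vertex_partition v partP).
have memv v : v \in pblock P v by case/andP: (pblock_vertex_partition v partP).
pose R := pblock P (hub m h); pose b j := pblock P (rim m h j).
have hub_rim j : hub m h -- rim m h j by [].
have rim_rim j : j < m.+1 -> rim m h j -- rim m h j.+1.
  by move=> jm; rewrite /= /fan_adj /= !inordK ?eqxx //; lia.
have rim_inj : {in [pred j | j < m.+2] &, injective (rim m h)}.
  by move=> i j im jm /eqP; rewrite rim_eq // => /eqP.
have b_step i : i < m.+1 -> [|| b i == R, b i.+1 == R | b i == b i.+1].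
  move=> im; have := tree_partition_triangle treeP
    (hub_rim i) (rim_rim i im) (hub_rim i.+1).
  by rewrite -/R -/(b _) -/(b _) !(eq_sym R) orbA orbAC -orbA.
pose L := [set i : 'I_m.+1 | (b i == R) && (b i.+1 != R)].
pose E := [set i : 'I_m.+1 | (b i != R) && (b i.+1 == R)].
pose F := [set b j | j : 'I_m.+2] :\ R.
have disLE : [disjoint L & E].
  by rewrite -setI_eq0; apply/eqP/setP=> i; rewrite !inE;
    case: (b i == R) => //=; rewrite andbF.
have LE i : (i \in L :|: E) = ((b i == R) != (b i.+1 == R)).
  by rewrite !inE; case: (b i == R); case: (b i.+1 == R).
have cardLE : #|L :|: E| = #|L| + #|E|.
  by rewrite cardsU disjoint_setI0 // cards0 subn0.
(* [L :|: E] is the set of switching edges. If it is empty, the [m.+2] rim vertices share one bag,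
   possibly [R]. *)
have [LE0|LE_gt0] := posnP #|L :|: E|.
  have bconst j : j <= m.+1 -> b j = b 0.
    apply: (no_switch_constant b_step) => i im.
    have := LE (Ordinal im); rewrite (cards0_eq LE0) inE /=.
    by case: (b i == R); case: (b i.+1 == R).
  have : m.+2 <= w.
    apply: leq_trans (bagw _ (memP (rim m h 0))).
    rewrite -[X in X <= _]card_ord.
    rewrite -(card_imset _ (f := fun j : 'I_m.+2 => rim m h j)).
      apply/subset_leq_card/subsetP=> _ /imsetP[j _ ->].
      by rewrite -/(b 0) -(bconst j) // -ltnS.
    by move=> i j /rim_inj; rewrite !inE !ltn_ord => /(_ isT isT) /val_inj.
  by lia.
(* The vertices forced into the bags of [R |: F]: hub, rim, and the ears on switching edges. *)
pose X : {set fan m h} := hub m h |: ([set rim m h j | j : 'I_m.+2] :|: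
  [set ear p.1 p.2 | p in setX (L :|: E) [set: 'I_h]]).
have cardX : #|X| = m.+3 + #|L :|: E| * h.
  rewrite cardsU1 cardsU disjoint_setI0; last first.
    rewrite -setI_eq0; apply/eqP/setP=> x; rewrite !inE.
    by apply/negP=> /andP[/imsetP[? _ ->] /imsetP[]].
  rewrite cards0 subn0 !card_imset ?cardsX ?cardsT ?card_ord.
  - rewrite inE negb_or; case: imsetP => [[] //|_].
    by case: imsetP => [[] //|_] /=; lia.
  - by move=> [i l] [i' l'] [-> ->].
  - by move=> i j /rim_inj; rewrite !inE !ltn_ord => /(_ isT isT) /val_inj.
have XF : X \subset cover (R |: F).
  have inF (A : {set fan m h}) v :
      v \in A -> A = R \/ (exists2 j, j < m.+2 & A = b j) ->
      v \in cover (R |: F).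
    move=> vA AF; apply/bigcupP; exists A => //; rewrite !inE.
    case: eqP AF => //= AR [//|[j jm ->]].
    by apply/imsetP; exists (Ordinal jm).
  apply/subsetP=> x; rewrite !inE => /orP[/eqP->|/orP[/imsetP[j _ ->]|]].
  - by apply: (inF R); [exact: memv | left].
  - by apply: (inF (b j)); [exact: memv | right; exists j].
  - case/imsetP=> [[i l]]; rewrite in_setX in_setT andbT LE /= => iLE -> {x}.
    have im := ltn_ord i.
    have rim_ear (j : nat) : (j == i) || (j == i.+1) -> rim m h j -- ear i l.
      by move=> ji; rewrite /= /fan_adj /= inordK ?ji //; lia.
    (* The ends of a switching edge lie in different bags, so the ear shares the bag of one of
       them. *)
    have := tree_partition_triangle treeP (rim_rim i im)
      (rim_ear i.+1 _) (rim_ear i _); rewrite !eqxx orbT => /(_ isT isT).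
    rewrite -/(b _) -/(b _) => tri.
    apply: (inF _ _ (memv _)); right; case/or3P: tri => /eqP tri.
    + by rewrite tri eqxx in iLE.
    + by exists i.+1.
    + by exists i => //; lia.
have Fw A : A \in R |: F -> #|A| <= w.
  rewrite !inE => /orP[/eqP->|/andP[_ /imsetP[j _ ->]]]; exact/bagw/memP.
have := leq_trans (subset_leq_card XF) (card_cover_leq Fw).
rewrite cardX cardsU1 setD11 add1n cardLE.
apply: fan_width_arith mh h4 _ (card_entries b_step) (card_exits b_step).
by rewrite -cardLE.
Qed.

Import Order.TTheory GRing.Theory Num.Theory.
Local Open Scope ring_scope.

Theorem theorem7 (Delta : nat) (odd_Delta : odd Delta)
    (Delta_ge11 : (11 <= Delta)%N) :
  exists G : sgraph,
    [/\ chordal G, treewidth G = 2%N, max_degree G = Delta &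
        2 / 3 * (Delta%:R - 1) <= (tpw G)%:R :> rat].
Proof.
(* An inner rim vertex then has degree 2h + 3 = Delta, the halving being exact because [Delta] is
   odd. *)
pose h := (Delta - 3)./2.
have DE : Delta = (2 * h).+3 by have := odd_double_half (Delta - 3); lia.
have h4 : (4 <= h)%N by lia.
exists (fan (2 * h).+1 h); split.
- exact: fan_chordal.
- exact: fan_treewidth.
- by rewrite fan_max_degree.
rewrite /tpw; case: ex_minnP => _ /asboolP[P [treeP <-]] _.
have := fan_tree_partition_width erefl h4 treeP.
rewrite -(ler_nat rat) !natrM => bound.
have -> : Delta%:R = (2 * h).+2%:R + 1 :> rat by rewrite natr1 DE.
lra.
Qed.
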